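(* Let $\lambda$ be an eigenvalue with elementary divisor of multiplicity $m$ ($m\ge2$) of the matrix $B$ corresponding to the real eigenvector $\nu^0$ and to the real generalized eigenvectors $\nu^k$ of order $k$, $k=1,\ldots,m-1$. Then the system $\dfrac{dx}{dt}=Ax+f(t)$ has the first integrals $$F_{k+1}\colon(t,x)\to(\nu^kx)\,e^{-\lambda t}-\sum_{i=0}^{k-1}\binom ki t^{k-i}F_{i+1}(t,x)-G_k(t)\quad\text{for all }(t,x)\in\widetilde J\times\mathbb R^n,\quad k=1,\ldots,m-1,$$ where $\widetilde J\subset J$ is an interval, $G_k$ is the iterated integral defined recursively by $$G_0(t)=\int(\nu^0f(t))\,e^{-\lambda t}\,dt,\qquad G_k(t)=\int\Bigl((\nu^kf(t))\,e^{-\lambda t}+k\,G_{k-1}(t)\Bigr)dt,\quad k=1,\ldots,m-1,$$ and $F_1$ is the first integral $$F_1\colon(t,x)\to(\nu^0x)\,e^{-\lambda t}-G_0(t)\quad\text{for all }(t,x)\in\widetilde J\times\mathbb R^n.$$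
   Context: $A$ is a real $n\times n$ matrix, $B=A^T$, $x\in\mathbb R^n$, and $f\colon J\to\mathbb R^n$ is continuous on an interval $J\subset\mathbb R$. For vectors, $\nu x=\sum_{i=1}^n\nu_ix_i$. If $\nu^0$ is an eigenvector of $B$ for the eigenvalue $\lambda$ with elementary divisor of multiplicity $m$, a nonzero vector $\nu^k$ is a generalized eigenvector of order $k$ for $\lambda$ if $(B-\lambda E)\nu^k=k\,\nu^{k-1}$, $k=1,\ldots,m-1$ ($E$ the identity matrix). Indefinite integrals denote antiderivatives on $\widetilde J$, each $G_k$ being chosen once and used throughout. A continuously differentiable function $F(t,x)$ is a first integral of $dx/dt=Ax+f(t)$ if $\partial_tF+\sum_{i=1}^n(Ax+f(t))_i\,\partial_{x_i}F=0$ on its domain. *)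

(* Defs.v *)
From HB Require Import structures.
From mathcomp Require Import all_boot all_order all_algebra.
From mathcomp Require Import all_classical all_reals all_analysis.

Set Implicit Arguments.
Unset Strict Implicit.
Unset Printing Implicit Defensive.

Import Order.TTheory GRing.Theory Num.Theory.
Import numFieldNormedType.Exports.

Local Open Scope classical_set_scope.
Local Open Scope ring_scope.

Section LinearAlgebra.
Context {R : fieldType} {n : nat}.
Implicit Types (B : 'M[R]_n) (lambda : R) (nu x : 'cV[R]_n).

Definition dotv nu x : R := \sum_i nu i ord0 * x i ord0.

(* The gcd (up to a nonzero constant) of all k x k minors of X E - B.  Choices
   of rows and columns that are not increasing only contribute zero minors and
   minors that already occur, up to sign.  The value at k = 0 is 1. *)
Definition determinantal_divisor B (k : nat) : {poly R} :=
  \big[@gcdp R/0]_(rs : {ffun 'I_k -> 'I_n})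
    \big[@gcdp R/0]_(cs : {ffun 'I_k -> 'I_n})
      \det (mxsub rs cs (char_poly_mx B)).

(* i_(k+1) = D_(k+1) / D_k, for k = 0, ..., n - 1. *)
Definition invariant_factor B (k : nat) : {poly R} :=
  determinantal_divisor B k.+1 %/ determinantal_divisor B k.

(* (X - lambda)^m is an elementary divisor of B: it is the exact power of
   X - lambda in one of the invariant factors. *)
Definition elementary_divisor B lambda (m : nat) : Prop :=
  (0 < m)%N /\
  exists k : 'I_n, mup lambda (invariant_factor B k) = m.

(* Column eigenvectors; [eigenvalue] in mathcomp is about row vectors. *)
Definition eigenvector B lambda nu : Prop :=
  nu != 0 /\ B *m nu = lambda *: nu.

(* Note the factor k on the right-hand side. *)
Definition generalized_eigenvector B lambda (nu : nat -> 'cV[R]_n) (k : nat) :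
    Prop :=
  nu k != 0 /\ (B - lambda%:M) *m nu k = k%:R *: nu k.-1.

End LinearAlgebra.

Section WithinDerivative.
Context {R : realType}.
Implicit Types (I : interval R) (g : R -> R) (t : R).

(* Derivative at t of g restricted to I: one-sided if t is an endpoint of I,
   and the ordinary derivative if t is interior to I.  It is meaningful only
   for t in I and I not reduced to a point. *)
Definition difference_quotient_at I g t : set_system R :=
  (s - t)^-1 * (g s - g t) @[s --> within [set` I] t^'].

Definition derivable_within I g t : Prop := cvg (difference_quotient_at I g t).

Definition derive_within I g t : R := lim (difference_quotient_at I g t).

Definition nondegenerate_itv I : Prop :=
  exists a b : R, [/\ a \in I, b \in I & a < b].

Definition antiderivative I (g G : R -> R) : Prop :=
  forall t, t \in I -> derivable_within I G t /\ derive_within I G t = g t.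

End WithinDerivative.

Section FirstIntegral.
Context {R : realType} {n : nat}.
Implicit Types (I : interval R) (F : R -> 'cV[R]_n -> R).

Definition partial_t I F (t : R) (x : 'cV[R]_n) : R :=
  derive_within I (F ^~ x) t.

Definition partial_x F (i : 'I_n) (t : R) (x : 'cV[R]_n) : R :=
  'D_(delta_mx i ord0) (F t) x.

Definition continuously_differentiable I F : Prop :=
  let D := [set` I] `*` [set: 'cV[R]_n] in
  [/\ forall t x, t \in I -> derivable_within I (F ^~ x) t,
      {within D, continuous (fun p => partial_t I F p.1 p.2)},
      forall i t x, t \in I -> derivable (F t) x (delta_mx i ord0)
    & forall i, {within D, continuous (fun p => partial_x F i p.1 p.2)}].

(* F is a first integral of dx/dt = A x + f(t) with domain I x R^n. *)
Definition first_integral (A : 'M[R]_n) (f : R -> 'cV[R]_n) I F : Prop :=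
  continuously_differentiable I F /\
  forall t x, t \in I ->
    partial_t I F t x +
      \sum_i (A *m x + f t) i ord0 * partial_x F i t x = 0.

End FirstIntegral.

(* Main.v *)
Require Import Defs.
From HB Require Import structures.
From mathcomp Require Import all_boot all_order all_algebra.
From mathcomp Require Import ring.
From mathcomp Require Import all_classical all_reals all_analysis.

Set Implicit Arguments.
Unset Strict Implicit.
Unset Printing Implicit Defensive.

Import Order.TTheory GRing.Theory Num.Theory.
Import numFieldNormedType.Exports.

Local Open Scope classical_set_scope.
Local Open Scope ring_scope.

(** Write X for the derivation d/dt + sum_i (A x + f(t))_i d/dx_i and
    H_k = (nu^k x) e^(-lambda t) - G_k.  The chain relation
    A^T nu^k = lambda nu^k + k nu^(k-1) gives
    X (nu^k x) = lambda nu^k x + k nu^(k-1) x + nu^k f; the factor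
    e^(-lambda t) cancels the term in lambda, and the integrand defining G_k
    cancels the forcing term and leaves X H_k = k H_(k-1).

    The definition of F_(k+1) says that
    H_k = sum_(i <= k) C(k, i) t^(k-i) F_(i+1).  Suppose that X F_(i+1) = 0
    for i < k.  Then X differentiates only the powers of t, and
      X F_(k+1) = k H_(k-1) - sum_(i < k) C(k, i) (k - i) t^(k-i-1) F_(i+1)
                = k (H_(k-1) - sum_(i <= k-1) C(k-1, i) t^(k-1-i) F_(i+1)),
    because (k - i) C(k, i) = k C(k-1, i).  The parenthesis vanishes: it is
    the definition of F_k.  So the induction needs no closed formula for
    F_(k+1), only that X is a derivation on continuously differentiable
    functions.

    The predicate [derives_along] packs together continuous differentiability
    and the value of X F.  It is stable under sums
    ([derives_alongD]) and products ([derives_alongM]) and holds for functions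
    of t alone ([derives_along_time]) and for linear forms in x
    ([derives_along_dotv]); [jordan_chain_integrals] is the induction, with
    k = 0 treated as a member of the chain. *)

(** * Linear forms on a Jordan chain *)

Section DotProduct.
Context {R : fieldType} {n : nat}.
Implicit Types (A : 'M[R]_n) (lambda : R) (nu x y : 'cV[R]_n).

Lemma dotvDl nu mu x : dotv (nu + mu) x = dotv nu x + dotv mu x.
Proof. by rewrite -big_split; apply: eq_bigr => i _; rewrite mxE mulrDl. Qed.

Lemma dotvZl a nu x : dotv (a *: nu) x = a * dotv nu x.
Proof.
by rewrite /dotv mulr_sumr; apply: eq_bigr => i _; rewrite mxE mulrA.
Qed.

Lemma dotvDr nu x y : dotv nu (x + y) = dotv nu x + dotv nu y.
Proof. by rewrite -big_split; apply: eq_bigr => i _; rewrite mxE mulrDr. Qed.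

Lemma dotvZr a nu x : dotv nu (a *: x) = a * dotv nu x.
Proof.
by rewrite /dotv mulr_sumr; apply: eq_bigr => i _; rewrite mxE mulrCA.
Qed.

Lemma dotvE nu x : dotv nu x = (nu^T *m x) ord0 ord0.
Proof. by rewrite mxE; apply: eq_bigr => i _; rewrite mxE. Qed.

Lemma dotv_mulmx nu A x : dotv nu (A *m x) = dotv (A^T *m nu) x.
Proof. by rewrite !dotvE trmx_mul trmxK mulmxA. Qed.

Lemma dotv_delta nu i : dotv nu (delta_mx i ord0) = nu i ord0.
Proof.
rewrite /dotv (bigD1 i) //= mxE !eqxx mulr1 big1 ?addr0 // => j ji.
by rewrite mxE (negbTE ji) mulr0.
Qed.

(** The transpose moves A onto nu, where the chain relation applies. *)
Lemma dotv_chain A lambda (nu : nat -> 'cV[R]_n) k x :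
  (A^T - lambda%:M) *m nu k = k%:R *: nu k.-1 ->
  dotv (nu k) (A *m x) = lambda * dotv (nu k) x + k%:R * dotv (nu k.-1) x.
Proof.
move=> /eqP; rewrite mulmxBl subr_eq mul_scalar_mx addrC => /eqP chain.
by rewrite dotv_mulmx chain dotvDl !dotvZl.
Qed.

End DotProduct.

(** * Derivatives relative to an interval *)

Section WithinDerivative.
Context {R : realType}.
Implicit Types (I : interval R) (g h : R -> R) (t : R).

(** Without points of I accumulating at t the limits defining [derive_within]
    would not be unique.  A nondegenerate interval containing t extends to at
    least one side of it. *)
Lemma within_dnbhs_proper I t : nondegenerate_itv I -> t \in I ->
  ProperFilter (within [set` I] t^').
Proof.
move=> [a [b [aI bI ab]]] tI; apply: Build_ProperFilter_ex => S.
rewrite /within /= => /nbhs_ballP[e /= e0 eS].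
have itvI := @interval_is_interval _ I.
have [ta|at_] := ltP t b.
  pose s := t + Num.min (e / 2) (b - t).
  have d0 : 0 < Num.min (e / 2) (b - t) by rewrite lt_min divr_gt0 ?subr_gt0.
  exists s; apply: eS.
  - rewrite /ball /= /s opprD addNKr normrN gtr0_norm //.
    by rewrite gt_min; apply/orP; left; rewrite ltr_pdivrMr // ltr_pMr // ltr1n.
  - by rewrite /s gt_eqF // ltrDl.
  - apply: (itvI t b) => //; rewrite /s lerDl (ltW d0) /=.
    by rewrite -lerBrDl ge_min lexx orbT.
have ta : a < t by exact: lt_le_trans at_.
pose s := t - Num.min (e / 2) (t - a).
have d0 : 0 < Num.min (e / 2) (t - a) by rewrite lt_min divr_gt0 ?subr_gt0.
exists s; apply: eS.
- rewrite /ball /= /s opprB addrC subrK gtr0_norm //.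
  by rewrite gt_min; apply/orP; left; rewrite ltr_pdivrMr // ltr_pMr // ltr1n.
- by rewrite /s lt_eqF // ltrBlDr ltrDl.
- apply: (itvI a t) => //; rewrite /s lerBlDr lerDl (ltW d0) andbT.
  by rewrite lerBrDr addrC -lerBrDr ge_min lexx orbT.
Qed.

(** Since g s - g t is s - t times a quotient with a finite limit, it tends
    to 0. *)
Lemma difference_quotient_at_dnbhs_cvg I g t (l : R) :
  difference_quotient_at I g t --> l ->
  g s @[s --> within [set` I] t^'] --> g t.
Proof.
rewrite /difference_quotient_at => gl.
(* At s = t both sides equal g t, whatever the value of the quotient. *)
rewrite [X in X @ _ --> _](_ : g =
  fun s => g t + (s - t) * ((s - t)^-1 * (g s - g t))); last first.
  apply/funext => s; have [->|st] := eqVneq s t.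
    by rewrite subrr mul0r addr0.
  by rewrite mulVKf ?subr_eq0// addrC subrK.
rewrite [X in _ --> X](_ : _ = g t + 0 * l); last by rewrite mul0r addr0.
apply: cvgD; first exact: cvg_cst.
apply: cvgM; last exact: gl.
rewrite -(subrr t); apply: cvgB; last exact: cvg_cst.
by do 2!apply: cvg_within_filter; exact: cvg_id.
Qed.

Lemma antiderivativeP I g G t : antiderivative I g G -> t \in I ->
  difference_quotient_at I G t --> g t.
Proof. by move=> GI tI; have [? <-] := GI t tI. Qed.

Lemma difference_quotient_at_within_cvg I g t (l : R) :
  difference_quotient_at I g t --> l ->
  g s @[s --> within [set` I] (nbhs t)] --> g t.
Proof.
move=> /difference_quotient_at_dnbhs_cvg gt S St; have gS := gt S St.
suff : \forall s \near t, s \in I -> S (g s) by [].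
have {gS} : \forall s \near t, s != t -> s \in I -> S (g s) by exact: gS.
apply: filterS => s SI Is; have [->|st] := eqVneq s t; last exact: SI.
exact: nbhs_singleton.
Qed.

Lemma is_derive_within I g t (d : R) : is_derive t 1 g d ->
  difference_quotient_at I g t --> d.
Proof.
move=> [dg <-]; apply: cvg_within_filter.
rewrite [X in X @ _ --> _](_ : _ =
  (fun h : R => h^-1 *: ((g \o shift t) (h *: 1) - g t)) \o
  (fun s : R => s - t)); last first.
  by apply/funext => s /=; rewrite scaler1 subrK.
have {}dg : h^-1 *: ((g \o shift t) (h *: 1) - g t) @[h --> 0^'] --> 'D_1 g t.
  exact: dg.
apply: cvg_comp dg => S S0.
suff : \forall s \near t, s != t -> S (s - t) by [].
have {}S0 : \forall h \near (0 : R), h != 0 -> S h by exact: S0.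
have st0 : (fun s => s - t) @ t --> (0 : R).
  by rewrite -(subrr t); apply: cvgB; [exact: cvg_id|exact: cvg_cst].
have : \forall s \near t, s - t != 0 -> S (s - t) by exact: st0 _ S0.
by apply: filterS => s; rewrite subr_eq0.
Qed.

Lemma difference_quotient_atD I g h t (dg dh : R) :
  difference_quotient_at I g t --> dg -> difference_quotient_at I h t --> dh ->
  difference_quotient_at I (fun s => g s + h s) t --> dg + dh.
Proof.
move=> gt ht; rewrite /difference_quotient_at.
rewrite (_ : (fun s => _) = (fun s => (s - t)^-1 * (g s - g t)
                                    + (s - t)^-1 * (h s - h t))).
  exact: cvgD gt ht.
by apply/funext => s; rewrite -mulrDr; congr (_ * _); ring.
Qed.

Lemma difference_quotient_atM I g h t (dg dh : R) :
  difference_quotient_at I g t --> dg -> difference_quotient_at I h t --> dh ->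
  difference_quotient_at I (fun s => g s * h s) t --> dg * h t + g t * dh.
Proof.
move=> gt ht; rewrite /difference_quotient_at.
rewrite (_ : (fun s => _) = (fun s => (s - t)^-1 * (g s - g t) * h s
                                    + g t * ((s - t)^-1 * (h s - h t)))).
  apply: cvgD; last by apply: cvgM ht; exact: cvg_cst.
  exact: cvgM gt (difference_quotient_at_dnbhs_cvg ht).
by apply/funext => s; ring.
Qed.

Lemma difference_quotient_at_eq I g h t (l : R) : t \in I -> {in I, g =1 h} ->
  difference_quotient_at I g t --> l -> difference_quotient_at I h t --> l.
Proof.
move=> tI gh; apply: cvg_trans; apply: near_eq_cvg.
by near=> s; rewrite !gh//; near: s; exact: near_withinT.
Unshelve. all: by end_near. Qed.

End WithinDerivative.

(** * Differentiation along the system *)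

Section DerivativeAlongFlow.
Context {R : realType} {n : nat}
  (A : 'M[R]_n) (f : R -> 'cV[R]_n) (I : interval R).
Implicit Types (F L : R -> 'cV[R]_n -> R) (g dg : R -> R) (nu : 'cV[R]_n).

Let D := [set` I] `*` [set: 'cV[R]_n].

(** F is continuously differentiable on I x R^n and L is its derivative along
    the solutions of dx/dt = A x + f(t).  Continuity of F itself is included
    because the partial derivatives of a product involve its factors. *)
Definition derives_along F L : Prop :=
  exists P (Q : 'I_n -> R -> 'cV[R]_n -> R),
  [/\ {within D, continuous (fun p => F p.1 p.2)},
      {within D, continuous (fun p => P p.1 p.2)},
      forall i, {within D, continuous (fun p => Q i p.1 p.2)} &
      forall t x, t \in I ->
      [/\ difference_quotient_at I (F ^~ x) t --> P t x,
          forall i, is_derive x (delta_mx i ord0) (F t) (Q i t x) &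
          L t x = P t x + \sum_i (A *m x + f t) i ord0 * Q i t x]].

Lemma derives_along_first_integral F : nondegenerate_itv I ->
  derives_along F (fun _ _ => 0) -> first_integral A f I F.
Proof.
move=> nI [P [Q [_ cP cQ FPQ]]].
have Pt t x : t \in I -> partial_t I F t x = P t x.
  move=> tI; have [FP _ _] := FPQ t x tI.
  have := within_dnbhs_proper nI tI => PF.
  exact: cvg_lim FP.
have Qt i t x : t \in I -> partial_x F i t x = Q i t x.
  by move=> tI; have [_ FQ _] := FPQ t x tI; exact: derive_val.
split; [split|].
- move=> t x tI; have [FP _ _] := FPQ t x tI.
  exact: cvgP FP.
- apply: subspace_eq_continuous cP => -[t x] /set_mem[/= tI _].
  exact/esym/Pt.
- by move=> i t x tI; have [_ FQ _] := FPQ t x tI; exact: ex_derive.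
- move=> i; apply: subspace_eq_continuous (cQ i) => -[t x] /set_mem[/= tI _].
  exact/esym/Qt.
- move=> t x tI; have [_ _ PQ0] := FPQ t x tI; rewrite [RHS]PQ0 Pt//.
  congr (_ + _).
  by apply: eq_bigr => i _; rewrite Qt.
Qed.

Lemma derives_along_eq F F' L L' :
  (forall t x, t \in I -> F t x = F' t x) ->
  (forall t x, t \in I -> L t x = L' t x) ->
  derives_along F L -> derives_along F' L'.
Proof.
move=> FF' LL' [P [Q [cF cP cQ FPQ]]]; exists P, Q; split=> //.
  by apply: subspace_eq_continuous cF => -[t x] /set_mem[/= tI _]; exact: FF'.
move=> t x tI; have [FP FQ FL] := FPQ t x tI; split.
- by apply: difference_quotient_at_eq FP => // s sI; exact: FF'.
- by rewrite -(_ : F t = F' t) //; apply/funext => y; exact: FF'.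
- by rewrite -LL'.
Qed.

Lemma derives_alongD F F' L L' : derives_along F L -> derives_along F' L' ->
  derives_along (fun t x => F t x + F' t x) (fun t x => L t x + L' t x).
Proof.
move=> [P [Q [cF cP cQ FPQ]]] [P' [Q' [cF' cP' cQ' FPQ']]].
exists (fun t x => P t x + P' t x), (fun i t x => Q i t x + Q' i t x); split.
- by move=> p; apply: cvgD; [exact: cF|exact: cF'].
- by move=> p; apply: cvgD; [exact: cP|exact: cP'].
- by move=> i p; apply: cvgD; [exact: cQ|exact: cQ'].
move=> t x tI; have [FP FQ ->] := FPQ t x tI; have [FP' FQ' ->] := FPQ' t x tI.
split; first exact: difference_quotient_atD.
  by move=> i; exact: is_deriveD.
rewrite addrACA; congr (_ + _); rewrite -big_split.
by apply: eq_bigr => i _; rewrite mulrDr.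
Qed.

Lemma derives_alongM F F' L L' : derives_along F L -> derives_along F' L' ->
  derives_along (fun t x => F t x * F' t x)
                (fun t x => L t x * F' t x + F t x * L' t x).
Proof.
move=> [P [Q [cF cP cQ FPQ]]] [P' [Q' [cF' cP' cQ' FPQ']]].
exists (fun t x => P t x * F' t x + F t x * P' t x),
       (fun i t x => F t x * Q' i t x + F' t x * Q i t x); split.
- by move=> p; apply: cvgM; [exact: cF|exact: cF'].
- move=> p; apply: cvgD; apply: cvgM;
    [exact: cP|exact: cF'|exact: cF|exact: cP'].
- move=> i p; apply: cvgD; apply: cvgM;
    [exact: cF|exact: cQ'|exact: cF'|exact: cQ].
move=> t x tI; have [FP FQ ->] := FPQ t x tI; have [FP' FQ' ->] := FPQ' t x tI.
split; first exact: difference_quotient_atM.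
  by move=> i; exact: is_deriveM.
rewrite mulrDl mulrDr addrACA; congr (_ + _).
rewrite mulr_suml mulr_sumr -big_split.
by apply: eq_bigr => i _ /=; ring.
Qed.

(** The derivative at t is only a limit relative to I: this covers the
    antiderivatives G_k, which may be one-sided at an endpoint of I and are
    arbitrary outside of I. *)
Lemma derives_along_time g dg :
  (forall t, t \in I -> difference_quotient_at I g t --> dg t) ->
  {within [set` I], continuous dg} ->
  derives_along (fun t _ => g t) (fun t _ => dg t).
Proof.
move=> gI cdg.
have lift (h : R -> R) : {within [set` I], continuous h} ->
    {within D, continuous (fun p : R * 'cV[R]_n => h p.1)}.
  move=> /subspace_continuousP ch.
  apply/subspace_continuousP => -[t x] [/= tI _].
  have fstI : fst @ within D (nbhs (t, x)) --> within [set` I] (nbhs t).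
    move=> S St; have St' : \forall s \near t, s \in I -> S s by exact: St.
    suff : \forall p \near (t, x), D p -> S p.1 by [].
    have St'' : \forall p \near (t, x), p.1 \in I -> S p.1.
      exact: (@cvg_fst _ _ (nbhs t) (nbhs x) _ _ St').
    by apply: filterS St'' => p SI [pI _]; exact: SI.
  exact: cvg_comp fstI (ch t tI).
exists (fun t _ => dg t), (fun _ _ _ => 0); split.
- apply: (lift g); apply/subspace_continuousP => t tI.
  exact: difference_quotient_at_within_cvg (gI t tI).
- exact: lift.
- by move=> i p; exact: cvg_cst.
move=> t x tI; split.
- exact: (gI t tI).
- by move=> i; exact: is_derive_cst.
- by rewrite big1 ?addr0 // => i _; rewrite mulr0.
Qed.

Lemma dotv_continuous nu : continuous (dotv nu).
Proof.
move=> x.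
apply: (@cvg_big _ _ +%R 0 predT add_continuous _ (nbhs x) _
  (fun i y => nu i ord0 * y i ord0)) => i _.
by apply: cvgM; [exact: cvg_cst|exact: coord_continuous].
Qed.

Lemma is_derive_dotv nu x v : is_derive x v (dotv nu) (dotv nu v).
Proof.
have slope h : h != 0 ->
    h^-1 *: ((dotv nu \o shift x) (h *: v) - dotv nu x) = dotv nu v.
  by move=> h0; rewrite /= dotvDr dotvZr addrK /GRing.scale /= mulKf.
have d : h^-1 *: ((dotv nu \o shift x) (h *: v) - dotv nu x) @[h --> 0^']
    --> dotv nu v.
  apply: cvg_near_cst; near=> h; rewrite slope //.
  by near: h; exact: nbhs_dnbhs_neq.
by split; [exact: cvgP d|exact: cvg_lim d].
Unshelve. all: by end_near. Qed.

Lemma derives_along_dotv nu :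
  derives_along (fun _ x => dotv nu x) (fun t x => dotv nu (A *m x + f t)).
Proof.
exists (fun _ _ => 0), (fun i _ _ => nu i ord0); split.
- apply: continuous_subspaceT => p.
  by apply: cvg_comp; [exact: cvg_snd|exact: dotv_continuous].
- by move=> p; exact: cvg_cst.
- by move=> i p; exact: cvg_cst.
move=> t x tI; split.
- rewrite /difference_quotient_at.
  under eq_fun do rewrite subrr mulr0.
  exact: cvg_cst.
- by move=> i; rewrite -dotv_delta; exact: is_derive_dotv.
- by rewrite add0r; apply: eq_bigr => i _; rewrite mulrC.
Qed.

Lemma derives_along_smooth g dg :
  (forall t : R, is_derive t (1 : R) g (dg t)) -> continuous dg ->
  derives_along (fun t _ => g t) (fun t _ => dg t).
Proof.
move=> gdg cdg; apply: derives_along_time; last exact: continuous_subspaceT.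
by move=> t _; exact: is_derive_within.
Qed.


Lemma derives_along_cst (c : R) :
  derives_along (fun _ _ => c) (fun _ _ => 0).
Proof.
exact: derives_along_smooth (fun t => is_derive_cst c t (1 : R))
  (@cst_continuous _ _ (0 : R)).
Qed.

Lemma derives_alongN F L : derives_along F L ->
  derives_along (fun t x => - F t x) (fun t x => - L t x).
Proof.
move=> /(derives_alongM (derives_along_cst (-1))).
by apply: derives_along_eq => t x _; rewrite mulN1r // mul0r add0r.
Qed.

Lemma derives_along_sum k (F L : nat -> R -> 'cV[R]_n -> R) :
  (forall i, (i < k)%N -> derives_along (F i) (L i)) ->
  derives_along (fun t x => \sum_(i < k) F i t x)
                (fun t x => \sum_(i < k) L i t x).
Proof.
elim: k => [_|k IHk FL].
  by apply: derives_along_eq (derives_along_cst 0) => t x _; rewrite big_ord0.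
have := derives_alongD (IHk (fun i ik => FL i (ltnW ik))) (FL k (ltnSn k)).
by apply: derives_along_eq => t x _; rewrite big_ord_recr.
Qed.

Lemma derives_along_monomial (c : R) j :
  derives_along (fun t _ => c * t ^+ j) (fun t _ => c * (j%:R * t ^+ j.-1)).
Proof.
apply: (@derives_along_smooth (fun t => c * t ^+ j)
                              (fun t => c * (j%:R * t ^+ j.-1))) => [t|].
  rewrite (_ : c * _ = c *: ((j%:R * t ^+ j.-1) *: (1 : R))); last first.
    by rewrite /GRing.scale /= mulr1.
  have := is_deriveZ c (is_deriveX j (is_derive_id t (1 : R))).
  by rewrite exprfctE.
by move=> t; do 2!(apply: cvgM; first exact: cvg_cst); exact: exprn_continuous.
Qed.

Lemma derives_along_exp lambda :
  derives_along (fun t _ => expR (- (lambda * t)))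
                (fun t _ => - lambda * expR (- (lambda * t))).
Proof.
apply: (@derives_along_smooth (fun t => expR (- (lambda * t)))
   (fun t => - lambda * expR (- (lambda * t)))) => t.
  have dlin : is_derive t (1 : R) (fun s => - (lambda * s)) (- lambda).
    have := is_deriveZ (- lambda) (is_derive_id t (1 : R)).
    rewrite [in X in X -> _]/GRing.scale /= mulr1; congr is_derive.
    by apply/funext => s; rewrite -mulNr.
  by rewrite mulrC; exact: is_derive1_comp.
apply: cvgM; first exact: cvg_cst.
apply: continuous_cvg; first exact: continuous_expR.
apply: cvgN; apply: cvgM; first exact: cvg_cst.
exact: cvg_id.
Qed.

End DerivativeAlongFlow.

(** * The recursion for the integrals *)

Lemma within_continuous_forcing (R : realType) (n : nat) (I : interval R)
    (f : R -> 'cV[R]_n) (nu : 'cV[R]_n) lambda :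
  {within [set` I], continuous f} ->
  {within [set` I],
    continuous (fun t => dotv nu (f t) * expR (- (lambda * t)))}.
Proof.
move=> cf t; apply: cvgM.
  by apply: continuous_cvg; [exact: dotv_continuous|exact: cf].
apply: continuous_subspaceT => {}t.
apply: continuous_cvg; first exact: continuous_expR.
by apply: cvgN; apply: cvgM; [exact: cvg_cst|exact: cvg_id].
Qed.

(** Here F is indexed from 0, so that [F k] is the integral attached to [nu k].
    At k = 0 the factor k removes the term in k.-1, and the last three
    hypotheses become the eigenvector equation and the definitions of G_0 and
    F_1. *)
Lemma jordan_chain_integrals (R : realType) (n : nat) (A : 'M[R]_n)
    (f : R -> 'cV[R]_n) (I : interval R) (lambda : R) (N : nat)
    (nu : nat -> 'cV[R]_n) (G : nat -> R -> R) (F : nat -> R -> 'cV[R]_n -> R) :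
  {within [set` I], continuous f} ->
  (forall k, (k <= N)%N ->
     (A^T - lambda%:M) *m nu k = k%:R *: nu k.-1) ->
  (forall k, (k <= N)%N -> antiderivative I
     (fun t => dotv (nu k) (f t) * expR (- (lambda * t)) + k%:R * G k.-1 t)
     (G k)) ->
  (forall k, (k <= N)%N -> forall t x, t \in I ->
     F k t x = dotv (nu k) x * expR (- (lambda * t))
       - \sum_(i < k) 'C(k, i)%:R * t ^+ (k - i) * F i t x - G k t) ->
  forall k, (k <= N)%N -> derives_along A f I (F k) (fun _ _ => 0).
Proof.
move=> cf chain GI FE.
have GP k t : (k <= N)%N -> t \in I -> difference_quotient_at I (G k) t -->
    dotv (nu k) (f t) * expR (- (lambda * t)) + k%:R * G k.-1 t.
  by move=> kN tI; exact: (antiderivativeP (GI k kN) tI).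
(* Needed because [G k.-1] enters the derivative of [G k], which has to be
   continuous. *)
have cG k : (k <= N)%N -> {within [set` I], continuous (G k)}.
  move=> kN; apply/subspace_continuousP => t tI.
  exact: difference_quotient_at_within_cvg (GP k t kN tI).
elim/ltn_ind => k IHk kN.
have cdG : {within [set` I], continuous (fun t =>
    dotv (nu k) (f t) * expR (- (lambda * t)) + k%:R * G k.-1 t)}.
  move=> t; apply: cvgD; first exact: within_continuous_forcing.
  apply: cvgM; first exact: cvg_cst.
  by apply: cG; exact: leq_trans (leq_pred k) kN.
have dG := derives_along_time A f (fun t => GP k t kN) cdG.
have dlin := derives_alongM (derives_along_dotv A f I (nu k))
  (derives_along_exp A f I lambda).
have dsum := derives_along_sum (fun i (ik : (i < k)%N) =>
  derives_alongM (derives_along_monomial A f I 'C(k, i)%:R (k - i))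
                 (IHk i ik (leq_trans (ltnW ik) kN))).
have := derives_alongD (derives_alongD dlin (derives_alongN dsum))
  (derives_alongN dG).
apply: derives_along_eq => t x tI; first by rewrite FE.
rewrite dotvDr (dotv_chain x (chain k kN)).
case: k {IHk dG dlin dsum cdG} kN => [|k] kN; first by rewrite big_ord0; ring.
(* The powers of t contribute k+1 times the sum that defines [F k], plus
   [F k] itself, which is the last summand: together, k+1 times H_k. *)
have Ek : \sum_(i < k.+1) ('C(k.+1, i)%:R * ((k.+1 - i)%:R * t ^+ (k.+1 - i).-1)
      * F i t x + 'C(k.+1, i)%:R * t ^+ (k.+1 - i) * 0)
    = k.+1%:R * (dotv (nu k) x * expR (- (lambda * t)) - G k t).
  have {}kN := ltnW kN.
  transitivity (k.+1%:R *
      \sum_(i < k.+1) 'C(k, i)%:R * t ^+ (k - i) * F i t x).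
    rewrite mulr_sumr; apply: eq_bigr => i _.
    rewrite mulr0 addr0 !mulrA -!natrM [X in X%:R]mulnC -mul_bin_down.
    by rewrite /= subSn // -ltnS.
  rewrite big_ord_recr /= binn subnn FE //; congr (_ * _); ring.
rewrite Ek /=; ring.
Qed.

Theorem theorem3p11 (R : realType) (n : nat) (A : 'M[R]_n)
    (J : interval R) (f : R -> 'cV[R]_n)
    (f_cont : {within [set` J], continuous f})
    (lambda : R) (m : nat) (m_ge2 : (2 <= m)%N)
    (lambda_m : elementary_divisor A^T lambda m)
    (nu : nat -> 'cV[R]_n)
    (nu0 : eigenvector A^T lambda (nu 0%N))
    (nuk : forall k, (1 <= k <= m - 1)%N ->
       generalized_eigenvector A^T lambda nu k)
    (Jt : interval R) (Jt_nondeg : nondegenerate_itv Jt)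
    (Jt_sub : [set` Jt] `<=` [set` J])
    (G : nat -> R -> R)
    (G0 : antiderivative Jt
       (fun t => dotv (nu 0%N) (f t) * expR (- (lambda * t))) (G 0%N))
    (Gk : forall k, (1 <= k <= m - 1)%N ->
       antiderivative Jt
         (fun t => dotv (nu k) (f t) * expR (- (lambda * t))
                   + k%:R * G k.-1 t) (G k))
    (F : nat -> R -> 'cV[R]_n -> R)
    (F1 : forall t x, t \in Jt ->
       F 1%N t x = dotv (nu 0%N) x * expR (- (lambda * t)) - G 0%N t)
    (Fk : forall k, (1 <= k <= m - 1)%N -> forall t x, t \in Jt ->
       F k.+1 t x = dotv (nu k) x * expR (- (lambda * t))
         - \sum_(i < k) 'C(k, i)%:R * t ^+ (k - i) * F i.+1 t x
         - G k t) :
  first_integral A f Jt (F 1%N) /\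
  (forall k, (1 <= k <= m - 1)%N -> first_integral A f Jt (F k.+1)).
Proof.
have cf : {within [set` Jt], continuous f}.
  exact: continuous_subspaceW f_cont.
have mE k : (k <= m - 1)%N -> (k == 0%N) || (1 <= k <= m - 1)%N.
  by move=> ->; rewrite andbT; case: k.
have main k : (k <= m - 1)%N -> first_integral A f Jt (F k.+1).
  move=> km; apply: derives_along_first_integral => //.
  apply: (@jordan_chain_integrals R n A f Jt lambda (m - 1) nu G
    (fun i => F i.+1)) km => // {}k /mE /orP[/eqP ->|km].
  - by rewrite mulmxBl mul_scalar_mx (proj2 nu0) subrr scale0r.
  - by have [] := nuk _ km.
  - by under eq_fun do rewrite mul0r addr0.
  - exact: Gk.
  - by move=> t x tJ; rewrite F1 // big_ord0 subr0.
  - exact: Fk.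
by split=> [|k /andP[_ km]]; exact: main.
Qed.
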